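(* Let $E$ be a finite simple directed graph (without repeated edges or loops), let $(\mathcal{M},+)$ be a closed submonoid of $(\mathbb{R}_{\ge 0},+)$, and let $N\in\mathcal{M}$. Then the supremum of $\mathrm{ct}^E_{\mathcal{M}}(\Gamma)$ over all $\mathcal{M}$-labeled directed graphs $\Gamma$ of weight $N$ is equal to the supremum of $\mathrm{ct}^E_{\mathcal{M}}(\Gamma)$ over only those $\mathcal{M}$-labeled directed graphs $\Gamma$ of weight $N$ that have the following property: every two distinct edges of $\Gamma$ belong to some common subgraph of $\Gamma$ isomorphic to $E$.
   Context: All graphs are finite and directed. A closed submonoid $\mathcal{M}$ of $(\mathbb{R}_{\ge 0},+)$ is a topologically closed subset containing $0$ and closed under addition. An $\mathcal{M}$-labeled directed graph is a directed graph without repeated edges in which every ordered pair $(x,y)$ of vertices carries a label $\ell(x,y)\in\mathcal{M}$, with $\ell(x,y)=0$ precisely when $(x,y)$ is not an edge. The weight of an $\mathcal{M}$-labeled graph $\Gamma$ is $\mathrm{wt}\,\Gamma=\sum_{\text{edges }(x,y)}\ell(x,y)$ and its content is $\mathrm{ct}\,\Gamma=\prod_{\text{edges }(x,y)}\ell(x,y)$. For a fixed finite simple directed graph $E$, set $$\mathrm{ct}^E_{\mathcal{M}}(\Gamma):=\sum_{\alpha}\mathrm{ct}(\alpha),$$ where $\alpha$ ranges over the (not necessarily induced) subgraphs of $\Gamma$ isomorphic to $E$, the edges of $\alpha$ carrying the labels inherited from $\Gamma$. *)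

(* Defs.v *)
From HB Require Import structures.
From mathcomp Require Import all_boot all_order all_algebra.
From mathcomp Require Import all_classical all_reals all_analysis.
Import Order.TTheory GRing.Theory Num.Theory.
Import numFieldNormedType.Exports.

Set Implicit Arguments.
Unset Strict Implicit.
Unset Printing Implicit Defensive.

Local Open Scope ring_scope.

(* Loops are allowed, repeated edges are not; no nonemptiness is assumed. *)
Record digraph := Digraph {
  vertex :> finType;
  edge : rel vertex
}.

Definition simple_digraph (E : digraph) : Prop := irreflexive (@edge E).

Definition closed_submonoid (R : realType) (M : set R) : Prop :=
  [/\ forall x, M x -> 0 <= x, closed M, M 0
    & forall x y, M x -> M y -> M (x + y)].

Record labeled_digraph (R : realType) (M : set R) := LabeledDigraph {
  underlying :> digraph;
  label : underlying -> underlying -> R;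
  label_in : forall x y, M (label x y);
  label_eq0 : forall x y, label x y = 0 <-> ~~ edge x y
}.

Definition weight (R : realType) (M : set R) (G : labeled_digraph M) : R :=
  \sum_(e : G * G | edge e.1 e.2) label e.1 e.2.

(* A candidate subgraph of G is a pair (vertex set, edge set). Keeping the
   vertex set matters when E has isolated vertices: subgraphs with the same
   edges and different vertices are then counted separately. *)
Definition is_subgraph (G : digraph) (a : {set G} * {set G * G}) : bool :=
  [forall e in a.2, [&& edge e.1 e.2, e.1 \in a.1 & e.2 \in a.1]].

Definition iso_to (E G : digraph) (a : {set G} * {set G * G}) : bool :=
  [exists f : {ffun E -> G},
    [&& injectiveb f, f @: [set: E]%SET == a.1
      & [forall x, forall y, edge x y == ((f x, f y) \in a.2)]]].

Definition copy_of (E G : digraph) (a : {set G} * {set G * G}) : bool :=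
  is_subgraph a && iso_to E a.

Definition content (R : realType) (M : set R) (G : labeled_digraph M)
    (a : {set G} * {set G * G}) : R :=
  \prod_(e in a.2) label e.1 e.2.

(* The sum runs over subgraphs, not over embeddings of E. *)
Definition ctE (R : realType) (M : set R) (E : digraph)
    (G : labeled_digraph M) : R :=
  \sum_(a : {set G} * {set G * G} | copy_of E a) content a.

Definition edges_pairwise_in_copy (E G : digraph) : Prop :=
  forall e1 e2 : G * G,
    edge e1.1 e1.2 -> edge e2.1 e2.2 -> e1 <> e2 ->
    exists a : {set G} * {set G * G},
      [/\ copy_of E a, e1 \in a.2 & e2 \in a.2].

(* Main.v *)
Require Import Defs.
From HB Require Import structures.
From mathcomp Require Import all_boot all_order all_algebra.
From mathcomp Require Import all_classical all_reals all_analysis.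
From mathcomp Require Import ring.
Import Order.TTheory GRing.Theory Num.Theory.
Import numFieldNormedType.Exports.

Local Open Scope classical_set_scope.
Local Open Scope ring_scope.

(** It suffices to replace every graph by one of the same weight, with at least
    the same content, in which any two distinct edges lie in a common copy of
    [E].  Suppose that two distinct edges [s] and [t] of the graph lie in no
    common copy.  Then no monomial of the content contains both labels, so the
    content is an affine function of the pair of labels of [s] and [t].  On the
    segment where the sum of these two labels is fixed, it is therefore at most
    its larger value at the two endpoints, that is, at the labellings where all
    of the label of one edge has been moved onto the other one
    ([content_transfer_barycenter]).  The endpoints are again labelled in [M],
    because [M] is closed under addition, and they have one edge less; so the
    replacement can be repeated only finitely often ([exists_improvement]).

    The argument keeps the vertex set [V] and changes only the labelling
    [l : V * V -> R].  For this the content is written as a polynomial that does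
    not depend on the edge set: the sum is extended to all copies of [E] in the
    complete digraph on [V], since a copy that uses a non-edge contributes a
    zero product ([ctE_labelling_content]). *)

(** The complete digraph has all loops, so that every digraph on [V] is one of
    its subgraphs. *)
Definition complete_digraph (V : finType) : digraph :=
  @Digraph V (fun _ _ => true).

Definition labelling_content {R : realType} (E : digraph) {V : finType}
    (l : V * V -> R) : R :=
  \sum_(a : {set V} * {set V * V} | @copy_of E (complete_digraph V) a)
    \prod_(e in a.2) l e.

Definition transfer {R : realType} {V : finType} (l : V * V -> R)
    (s t : V * V) : V * V -> R :=
  fun e => if e == s then 0 else if e == t then l s + l t else l e.

Section Transfer.
Context (R : realType) (V : finType) (l : V * V -> R).
Implicit Types (s t : V * V) (A : {set V * V}).

Lemma prod_transfer_source s t A :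
  s \in A -> \prod_(e in A) transfer l s t e = 0.
Proof. by move=> sA; rewrite (bigD1 s) //= /transfer eqxx mul0r. Qed.

Lemma prod_transfer_avoid s t A : s \notin A -> t \notin A ->
  \prod_(e in A) transfer l s t e = \prod_(e in A) l e.
Proof.
move=> sA tA; apply: eq_bigr => e eA; rewrite /transfer.
by rewrite (negPf (memPn sA e eA)) (negPf (memPn tA e eA)).
Qed.

Lemma prod_transfer_target s t A : s \notin A -> t \in A ->
  l t * \prod_(e in A) transfer l s t e =
  (l s + l t) * \prod_(e in A) l e.
Proof.
move=> sA tA; rewrite (bigD1 t) //= [in RHS](bigD1 t) //=.
rewrite {1}/transfer (negPf (memPn sA t tA)) eqxx.
rewrite (eq_bigr l) => [|e /andP[eA /negPf et]]; first by ring.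
by rewrite /transfer (negPf (memPn sA e eA)) et.
Qed.

(** Divided by [l s + l t], this is affinity of the monomial along the segment:
    the given labelling is the mean of the two endpoints with weights
    [l t : l s], since it leaves the share [l t] of the total on [t].  The
    monomial fails to be affine only if it contains both labels, which the
    hypothesis makes harmless: it then vanishes at all three labellings. *)
Lemma prod_transfer_barycenter s t A :
    (s \in A -> t \in A -> \prod_(e in A) l e = 0) ->
  (l s + l t) * \prod_(e in A) l e =
  l t * \prod_(e in A) transfer l s t e +
  l s * \prod_(e in A) transfer l t s e.
Proof.
case: (boolP (s \in A)) => sA; case: (boolP (t \in A)) => tA st.
- by rewrite st // !prod_transfer_source // !mulr0 addr0.
- by rewrite prod_transfer_source // prod_transfer_target // mulr0 add0r addrC.
- by rewrite prod_transfer_target // prod_transfer_source // mulr0 addr0.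
- by rewrite !prod_transfer_avoid //; ring.
Qed.

Lemma content_transfer_barycenter (E : digraph) s t :
    (forall a : {set V} * {set V * V}, @copy_of E (complete_digraph V) a ->
      s \in a.2 -> t \in a.2 -> \prod_(e in a.2) l e = 0) ->
  (l s + l t) * labelling_content E l =
  l t * labelling_content E (transfer l s t) +
  l s * labelling_content E (transfer l t s).
Proof.
move=> st; rewrite /labelling_content !mulr_sumr -big_split /=.
by apply: eq_bigr => a aE; apply: prod_transfer_barycenter; apply: st.
Qed.

Lemma sum_transfer s t : s != t ->
  \sum_e transfer l s t e = \sum_e l e.
Proof.
move=> st; have ts : t != s by rewrite eq_sym.
rewrite (bigD1 s) //= (bigD1 t) //= [RHS](bigD1 s) //= (bigD1 t (P := predC1 s)) //=.
rewrite /transfer eqxx (negPf ts) eqxx add0r addrA; congr (_ + _).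
by apply: eq_bigr => e /andP[/negPf -> /negPf ->].
Qed.

Lemma card_support_transfer s t : l s != 0 -> l t != 0 ->
  (#|[pred e | transfer l s t e != 0%R]| < #|[pred e | l e != 0%R]|)%N.
Proof.
move=> ls lt; apply: proper_card; apply/fintype.properP; split.
  apply/fintype.subsetP => e; rewrite !inE /transfer.
  by case: ifP => [_|_]; [rewrite eqxx|case: ifP => // /eqP ->].
by exists s; rewrite !inE // /transfer eqxx eqxx.
Qed.

End Transfer.

Lemma transfer_in (R : realType) (V : finType) (M : set R) (l : V * V -> R)
    (s t : V * V) :
  closed_submonoid M -> (forall e, M (l e)) ->
  forall e, M (transfer l s t e).
Proof.
move=> [_ _ M0 MD] Ml e; rewrite /transfer.
by case: ifP => // _; case: ifP => // _; apply: MD.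
Qed.

(** The nonzero product says that the copy, taken in the complete digraph, uses
    only edges of the labelled graph. *)
Definition labelling_pairwise_in_copy {R : realType} (E : digraph)
    {V : finType} (l : V * V -> R) : Prop :=
  forall s t : V * V, l s != 0 -> l t != 0 -> s <> t ->
  exists a : {set V} * {set V * V},
    [/\ @copy_of E (complete_digraph V) a, s \in a.2, t \in a.2
      & \prod_(e in a.2) l e != 0].

(** Each transfer onto the better endpoint removes an edge, whence the induction
    on the size of the support. *)
Lemma exists_improvement (R : realType) (E : digraph) (V : finType)
    (M : set R) (l : V * V -> R) :
    closed_submonoid M -> (forall e, M (l e)) ->
  exists l' : V * V -> R,
    [/\ forall e, M (l' e), \sum_e l' e = \sum_e l e,
        labelling_content E l <= labelling_content E l'
      & labelling_pairwise_in_copy E l'].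
Proof.
move=> hM; have [n] := ubnP #|[pred e | l e != 0%R]|.
elim: n l => // n IHn l suppl Ml.
have [good|] := pselect (labelling_pairwise_in_copy E l).
  by exists l.
move=> /existsNP[s] /existsNP[t].
move=> /not_implyP[ls] /not_implyP[lt] /not_implyP[/eqP st nocopy].
have improve u v : u != v -> l u != 0 -> l v != 0 ->
    labelling_content E l
      <= labelling_content E (transfer l u v) ->
  exists l' : V * V -> R,
    [/\ forall e, M (l' e), \sum_e l' e = \sum_e l e,
        labelling_content E l <= labelling_content E l'
      & labelling_pairwise_in_copy E l'].
  move=> uv lu lv le_uv.
  have [||l' [Ml' wl' cl' pl']] := IHn (transfer l u v).
  - by apply: (leq_trans (card_support_transfer R V l u v lu lv)); rewrite -ltnS.
  - exact: transfer_in.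
  exists l'; split=> //; last exact: le_trans le_uv cl'.
  by rewrite wl' sum_transfer.
have lpos u : l u != 0 -> 0 < l u.
  by case: hM => M_ge0 _ _ _ lu; rewrite lt_neqAle eq_sym lu M_ge0.
have bary : (l s + l t) * labelling_content E l =
    l t * labelling_content E (transfer l s t) +
    l s * labelling_content E (transfer l t s).
  apply: content_transfer_barycenter => a aE sa ta.
  by apply/eqP; apply: contrapT => /negP la; apply: nocopy; exists a.
have [|lt_st] := leP (labelling_content E l)
  (labelling_content E (transfer l s t)); first exact: improve.
have [|lt_ts] := leP (labelling_content E l)
  (labelling_content E (transfer l t s)).
  by apply: improve => //; rewrite eq_sym.
(* If both endpoints were strictly worse, so would be their weighted mean. *)
move: (lpos s ls) (lpos t lt) => ls_gt0 lt_gt0.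
suff /lt_eqF/eqP : l t * labelling_content E (transfer l s t) +
    l s * labelling_content E (transfer l t s) <
    (l s + l t) * labelling_content E l by rewrite bary.
by rewrite addrC mulrDl; apply: ltrD; rewrite ltr_pM2l.
Qed.

Section LabeledDigraph.
Context {R : realType} {M : set R}.

Definition labelling (G : labeled_digraph M) : G * G -> R :=
  fun e => label e.1 e.2.

Lemma edge_labelling (G : labeled_digraph M) (e : G * G) :
  edge e.1 e.2 = (labelling G e != 0).
Proof.
apply/idP/idP => [ee|]; first by apply/eqP => /label_eq0/negP.
by apply: contraNT => /label_eq0 le0; apply/eqP.
Qed.

Lemma weight_labelling (G : labeled_digraph M) :
  weight G = \sum_e labelling G e.
Proof.
rewrite /weight big_mkcond /=; apply: eq_bigr => e _.
by rewrite edge_labelling; case: eqP.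
Qed.

(** Separates the condition on a copy that depends only on the vertex set from
    the one that depends on the edges. *)
Lemma copy_of_labelling (E : digraph) (G : labeled_digraph M)
    (a : {set G} * {set G * G}) :
  copy_of E a =
  @copy_of E (complete_digraph G) a && (\prod_(e in a.2) labelling G e != 0).
Proof.
rewrite /copy_of andbAC; congr (_ && _).
apply/forall_inP/andP => [sub|[/forall_inP sub /prodf_neq0 nz] e ea].
  split; first by apply/forall_inP => e /sub /andP[].
  by apply/prodf_neq0 => e /sub /andP[ee _]; rewrite -edge_labelling.
by rewrite edge_labelling nz // sub.
Qed.

Lemma ctE_labelling_content (E : digraph) (G : labeled_digraph M) :
  ctE E G = labelling_content E (labelling G).
Proof.
rewrite /ctE /labelling_content big_mkcond [RHS]big_mkcond /=.
apply: eq_bigr => a _; rewrite copy_of_labelling.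
by case: (@copy_of E (complete_digraph G) a) => //=; case: eqVneq.
Qed.

Lemma pairwise_in_copy_labelling (E : digraph) (G : labeled_digraph M) :
  labelling_pairwise_in_copy E (labelling G) ->
  edges_pairwise_in_copy E G.
Proof.
move=> pG s t; rewrite !edge_labelling => ls lt st.
have [a [aE sa ta la]] := pG s t ls lt st.
by exists a; split=> //; rewrite copy_of_labelling aE.
Qed.

Definition digraph_of_labelling {V : finType} (l : V * V -> R) : digraph :=
  @Digraph V (fun x y => l (x, y) != 0).

Lemma digraph_of_labelling_eq0 (V : finType) (l : V * V -> R)
    (x y : digraph_of_labelling l) :
  l (x, y) = 0 <-> ~~ edge x y.
Proof. by rewrite /= negbK; split=> /eqP. Qed.

Definition graph_of_labelling {V : finType} (l : V * V -> R)
    (Ml : forall e, M (l e)) : labeled_digraph M :=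
  @LabeledDigraph R M (digraph_of_labelling l) (fun x y => l (x, y))
    (fun x y => Ml (x, y)) (digraph_of_labelling_eq0 V l).

Lemma graph_of_labellingK (V : finType) (l : V * V -> R)
    (Ml : forall e, M (l e)) :
  labelling (graph_of_labelling l Ml) = l.
Proof. by apply/funext => -[]. Qed.

End LabeledDigraph.

Theorem theorem2p2 (R : realType) (E : digraph) (hE : simple_digraph E)
    (M : set R) (hM : closed_submonoid M) (N : R) (hN : M N) :
  ereal_sup [set x : \bar R | exists2 G : labeled_digraph M,
    weight G = N & x = (ctE E G)%:E] =
  ereal_sup [set x : \bar R | exists2 G : labeled_digraph M,
    weight G = N /\ edges_pairwise_in_copy E G & x = (ctE E G)%:E].
Proof.
apply/eqP; rewrite eq_le; apply/andP; split; last first.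
  by apply: le_ereal_sup => _ [G [wG _] ->]; exists G.
apply: ge_ereal_sup => _ [G wG ->].
have [|l [Ml wl cl pl]] :=
  exists_improvement R E G M (labelling G) hM.
  by move=> e; apply: label_in.
pose H := graph_of_labelling l Ml.
have HK : labelling H = l := graph_of_labellingK G l Ml.
apply: (@le_trans _ _ (ctE E H)%:E).
  by rewrite lee_fin !ctE_labelling_content HK.
apply: ereal_sup_ubound; exists H => //; split.
  by rewrite weight_labelling HK wl -weight_labelling.
by apply: pairwise_in_copy_labelling; rewrite HK.
Qed.
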